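(* For the nIP and nNIPG DG methods and any penalty parameter $\mu\ge1/\rho$, the bilinear form $B_h=E+J+\mu P$ is bounded: $$B_h(v,w)\le 2\,|||v|||\;|||w|||,\qquad\forall\, v,w\in V(h)=V_h+\mathcal{S}.$$
   Context: **Setting.** $\Omega=(a,b)$, $\delta>0$, $\Omega_\delta=[a-\delta,a]\cup[b,b+\delta]$, $\widetilde\Omega=\Omega\cup\Omega_\delta$. The kernel $\gamma_\delta$ is nonnegative, even, $s^2\gamma_\delta(s)\in L^1_{loc}(\mathbb{R})$, and normalized by $\int_{-\delta}^{\delta}s^2\gamma_\delta(s)\,ds=1$. All functions are extended by zero outside $\widetilde\Omega$; $E_s^+w(x)=w(x+s)-w(x)$. The energy space is $\mathcal{S}=\{v\in L^2(\widetilde\Omega):\|v\|_{\mathcal S}<\infty,\ v=0\text{ on }\Omega_\delta\}$ with $\|v\|_{\mathcal S}^2=2\int_0^\delta\gamma_\delta(s)\int_{\widetilde\Omega}(E_s^+v(x))^2\,dx\,ds$. **Mesh and space.** The mesh consists of intervals $I_j=(x_{j-1/2},x_{j+1/2})$, $j=-m+1,\dots,N+m$, with $x_{1/2}=a$, $x_{N+1/2}=b$, $x_{-m+1/2}\le a-\delta<x_{-m+3/2}$, $x_{N+m-1/2}<b+\delta\le x_{N+m+1/2}$. Put $h_j=x_{j+1/2}-x_{j-1/2}$, $h=\max_j h_j$, $\rho=\min_j h_j$, with $\nu h\le\rho$ for a fixed constant $\nu>0$. $V_h=\{v\in L^2(\widetilde\Omega): v|_{I_j}\in\mathcal{P}_k(I_j),\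 j=1,\dots,N,\ v|_{\Omega_\delta}=0\}$, where $\mathcal P_k(I_j)$ is the space of polynomials of degree at most $k$ on $I_j$. Sums $\sum_j$ run over all mesh indices. Set $\hat h=\min\{\rho,\delta\}$, $I_{j,2}^s=(x_{j+1/2}-s,x_{j+1/2})$, and $[\![w]\!]_{j+1/2}=w(x_{j+1/2}^+)-w(x_{j+1/2}^-)$. **Bilinear forms.** Let $g_v(x,s)=E_s^+v(x)-[\![v]\!]_{j+1/2}$ if $x\in I_{j,2}^s$ and $s\in(0,\hat h)$, and $g_v(x,s)=E_s^+v(x)$ otherwise. Define $$E(u,v)=2\int_0^\delta\gamma_\delta(s)\sum_j\int_{I_j}g_u(x,s)g_v(x,s)\,dx\,ds,\qquad P(u,v)=\int_0^{\hat h}s^2\gamma_\delta(s)\,ds\ \sum_j[\![u]\!]_{j+1/2}[\![v]\!]_{j+1/2},$$ $$K(u,v)=2\sum_j[\![v]\!]_{j+1/2}\int_0^{\hat h}\gamma_\delta(s)\int_{I_{j,2}^s}g_u(x,s)\,dx\,ds.$$ nIP (nonlocal interior penalty method): $J(u,v)=K(u,v)+K(v,u)$; nNIPG (nonlocal version of the nonsymmetric interior penalty Galerkin method): $J(u,v)=K(u,v)-K(v,u)$. In both methods the penalty parameter $\mu>0$ is taken with $\mu=O(h^{-1})$. **Norm.** $|v|_{E,h}^2=E(v,v)$, $|v|_{J,h}^2=2\sum_j h_j\int_0^{\hat h}\gamma_\delta(s)\frac1s\int_{I_{j,2}^s}g_v(x,s)^2\,dx\,ds$, $|v|_{P,h}^2=P(v,v)$,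 and $|||v|||^2=|v|_{E,h}^2+|v|_{J,h}^2+\mu|v|_{P,h}^2$ for $v\in V(h)$. *)

(* Defs.v *)
From HB Require Import structures.
From mathcomp Require Import all_boot all_order all_algebra.
From mathcomp Require Import all_classical all_reals all_analysis.

Set Implicit Arguments.
Unset Strict Implicit.
Unset Printing Implicit Defensive.

Import Order.TTheory GRing.Theory Num.Theory.
Import numFieldNormedType.Exports.

Local Open Scope classical_set_scope.
Local Open Scope ring_scope.

(* Elements of L^2(a - delta, b + delta) are represented by functions R -> R
   that vanish outside that interval.  Integrals, forms and norms take values
   in \bar R, because the mesh-dependent norm may be infinite at some elements
   of the energy space. *)

Definition omega_tilde (R : realType) (a b delta : R) : set R :=
  `[a - delta, b + delta].

Definition omega_delta (R : realType) (a b delta : R) : set R :=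
  `[a - delta, a] `|` `[b, b + delta].

Definition shift_diff (R : realType) (w : R -> R) (s x : R) : R :=
  w (x + s) - w x.

Record is_kernel (R : realType) (delta : R) (gamma : R -> R) : Prop := IsKernel {
  kernel_ge0 : forall s, 0 <= gamma s ;
  kernel_even : forall s, gamma (- s) = gamma s ;
  kernel_loc : locally_integrable setT (fun s => s ^+ 2 * gamma s) ;
  kernel_moment : (\int[lebesgue_measure]_(s in `[(- delta)%R, delta])
                     (s ^+ 2 * gamma s)%:E = 1)%E }.

(* The functions of L^2(omega_tilde), extended by zero, which vanish on
   omega_delta. *)
Definition L2_volume_constrained (R : realType) (a b delta : R)
    : set (R -> R) :=
  [set v | [/\ v \in Lfun lebesgue_measure 2%:E,
    forall x, ~ omega_tilde a b delta x -> v x = 0 &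
    forall x, omega_delta a b delta x -> v x = 0]].

Definition energy_norm_sq (R : realType) (a b delta : R) (gamma v : R -> R)
    : \bar R :=
  (2%:E * \int[lebesgue_measure]_(s in `]0%R, delta[)
    ((gamma s)%:E * \int[lebesgue_measure]_(x in omega_tilde a b delta)
                      ((shift_diff v s x) ^+ 2)%:E))%E.

Definition energy_space (R : realType) (a b delta : R) (gamma : R -> R)
    : set (R -> R) :=
  [set v | L2_volume_constrained a b delta v /\
           (energy_norm_sq a b delta gamma v < +oo)%E].

(* node j stands for x_{j+1/2}, so that I_j = (node (j - 1), node j); only the
   nodes with - nghost <= j <= ncell + nghost are meaningful. *)
Record mesh (R : realType) := Mesh {
  ncell : nat ;
  nghost : nat ;
  node : int -> R }.

Section Mesh.
Context {R : realType}.
Implicit Types (M : mesh R) (j : int).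

(* - m + 1, ..., N + m *)
Definition mesh_idx M : seq int :=
  [seq i%:Z - (nghost M)%:Z + 1 | i <- iota 0 (ncell M + (nghost M).*2)].

Definition cell M j : set R := `]node M (j - 1), node M j[.

Definition cell_size M j : R := node M j - node M (j - 1).

(* I_1 is always a cell of the mesh, so its size is a legitimate default for
   the maximum and the minimum. *)
Definition mesh_size M : R :=
  \big[Num.max/cell_size M 1]_(j <- mesh_idx M) cell_size M j.

Definition mesh_min M : R :=
  \big[Num.min/cell_size M 1]_(j <- mesh_idx M) cell_size M j.

Record is_mesh (a b delta : R) M : Prop := IsMesh {
  node_lt : forall i j : int,
    - (nghost M)%:Z <= i -> i < j -> j <= (ncell M + nghost M)%N%:Z ->
    node M i < node M j ;
  node_a : node M 0 = a ;
  node_b : node M (ncell M)%:Z = b ;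
  node_left : node M (- (nghost M)%:Z) <= a - delta ;
  node_left_lt : a - delta < node M (- (nghost M)%:Z + 1) ;
  node_right_lt : node M ((ncell M + nghost M)%N%:Z - 1) < b + delta ;
  node_right : b + delta <= node M (ncell M + nghost M)%N%:Z }.

End Mesh.

Section DG.
Context {R : realType}.
Implicit Types (M : mesh R) (j : int) (gamma u v w : R -> R).

Definition dg_space (a b delta : R) M (k : nat) : set (R -> R) :=
  [set v | L2_volume_constrained a b delta v /\
    forall j, 1 <= j <= (ncell M)%:Z ->
      exists2 p : {poly R}, (size p <= k.+1)%N &
        forall x, cell M j x -> v x = p.[x]].

(* V_h + S *)
Definition dg_energy_space (a b delta : R) gamma M (k : nat) : set (R -> R) :=
  [set p \+ q | p in dg_space a b delta M k & q in energy_space a b delta gamma].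

(* The jump is the usual one wherever w has one-sided limits.  An element of
   the energy space need not have any; the total operator lim then picks an
   arbitrary value, and such functions are not excluded. *)
Definition jump M w j : R :=
  lim (w x @[x --> (node M j)^'+]) - lim (w x @[x --> (node M j)^'-]).

Definition h_hat (delta : R) M : R := Num.min (mesh_min M) delta.

Definition strip M j (s : R) : set R := `]node M j - s, node M j[.

(* g_v(x, s) for x in the cell I_j. Since s < h_hat <= h_j, the strip of index
   j is contained in I_j, so it is the only one that x can belong to. *)
Definition gdiff (delta : R) M v j (x s : R) : R :=
  if (x \in strip M j s) && (0 < s < h_hat delta M)
  then shift_diff v s x - jump M v j else shift_diff v s x.

Local Open Scope ereal_scope.

Definition form_E (delta : R) gamma M u v : \bar R :=
  2%:E * \int[lebesgue_measure]_(s in `]0%R, delta[)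
    ((gamma s)%:E * \sum_(j <- mesh_idx M)
       \int[lebesgue_measure]_(x in cell M j)
         (gdiff delta M u j x s * gdiff delta M v j x s)%:E).

Definition form_P (delta : R) gamma M u v : \bar R :=
  (\int[lebesgue_measure]_(s in `]0%R, (h_hat delta M)[)
     (s ^+ 2 * gamma s)%:E)
  * \sum_(j <- mesh_idx M) (jump M u j * jump M v j)%:E.

Definition form_K (delta : R) gamma M u v : \bar R :=
  2%:E * \sum_(j <- mesh_idx M) (jump M v j)%:E *
    \int[lebesgue_measure]_(s in `]0%R, (h_hat delta M)[)
      ((gamma s)%:E * \int[lebesgue_measure]_(x in strip M j s)
                        (gdiff delta M u j x s)%:E).

Inductive dg_method := nIP | nNIPG.

Definition form_J (meth : dg_method) (delta : R) gamma M u v : \bar R :=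
  match meth with
  | nIP => form_K delta gamma M u v + form_K delta gamma M v u
  | nNIPG => form_K delta gamma M u v - form_K delta gamma M v u
  end.

Definition form_B (meth : dg_method) (delta : R) gamma M (mu : R) u v : \bar R :=
  form_E delta gamma M u v + form_J meth delta gamma M u v
  + mu%:E * form_P delta gamma M u v.

Definition seminormJ_sq (delta : R) gamma M v : \bar R :=
  2%:E * \sum_(j <- mesh_idx M) (cell_size M j)%:E *
    \int[lebesgue_measure]_(s in `]0%R, (h_hat delta M)[)
      ((gamma s / s)%:E * \int[lebesgue_measure]_(x in strip M j s)
                            (gdiff delta M v j x s ^+ 2)%:E).

Definition dg_norm (delta : R) gamma M (mu : R) v : \bar R :=
  sqrte (form_E delta gamma M v v + seminormJ_sq delta gamma M v
         + mu%:E * form_P delta gamma M v v).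

End DG.

(* Main.v *)
Require Import Defs.
From HB Require Import structures.
From mathcomp Require Import all_boot all_order all_algebra.
From mathcomp Require Import all_classical all_reals all_analysis.
From mathcomp Require Import measurable_realfun ring lra zify.
Import Order.TTheory GRing.Theory Num.Theory.
Import numFieldNormedType.Exports.
Local Open Scope classical_set_scope.
Local Open Scope ring_scope.

(** Write e, j, p for the square roots of E(v,v), |v|_J^2 and mu P(v,v), and
    e', j', p' for those of w.  The Cauchy-Schwarz inequality bounds E(v,w) by
    e e' and mu P(v,w) by p p'.  Splitting gamma_delta(s) s^(1/2) as
    (s gamma_delta(s)^(1/2)) (gamma_delta(s) / s)^(1/2) and using 1 <= mu h_j, it
    bounds K(v,w) by sqrt 2 j p' and K(w,v) by sqrt 2 j' p.  The quadratic form
    e e' + sqrt 2 (j p' + j' p) + p p' has matrix of operator norm exactly 2.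
    The norms may be infinite, so Cauchy-Schwarz is proved in \bar R, with the
    convention 0 * +oo = 0. *)

(** * Cauchy-Schwarz inequalities for extended real sums and integrals *)

Section CauchySchwarz.
Local Open Scope ereal_scope.

(** With [0 * +oo = 0], the right side is 0 for [x = 0] and [+oo] otherwise. It records linearly in
    [x] that the product vanishes with [x], even when [y] is infinite. *)
Lemma sqrte_mul_le_mulyl (R : realType) (x y : \bar R) :
  0 <= x -> sqrte x * sqrte y <= +oo * x.
Proof.
rewrite le_eqVlt => /predU1P[<-|x0]; first by rewrite sqrte0 mul0e mule0.
by rewrite gt0_mulye ?leey.
Qed.

(* AM-GM for t x and y / (4 t), whose product is x y / 4. *)
Lemma sqrte_mul_le_amgm (R : realType) (t : R) (x y : \bar R) :
  (0 < t)%R -> 0 <= x -> 0 <= y ->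
  sqrte x * sqrte y <= t%:E * x + (4 * t)^-1%:E * y.
Proof.
move=> t0; have t4 : (0 < (4 * t)^-1)%R by rewrite invr_gt0 mulr_gt0.
case: x => [x| |]//; case: y => [y| |]// x0 y0; last 3 first.
- by rewrite [X in _ + X]gt0_muley ?lte_fin// addey ?leey.
- by rewrite gt0_muley ?lte_fin// addye ?leey.
- by rewrite [X in X + _]gt0_muley ?lte_fin// addye ?leey// gt0_muley.
rewrite /= -!EFinM -EFinD lee_fin.
move: x0 y0; rewrite !lee_fin => x0 y0.
rewrite -{2}(sqr_sqrtr x0) -{2}(sqr_sqrtr y0).
set a := Num.sqrt x; set b := Num.sqrt y.
rewrite -subr_ge0.
have -> : (t * a ^+ 2 + (4 * t)^-1 * b ^+ 2 - a * b =
           t * (a - b / (2 * t)) ^+ 2)%R by field; rewrite gt_eqF.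
by rewrite mulr_ge0 ?sqr_ge0 ?ltW.
Qed.

(** Converse of AM-GM: optimising over [t] recovers the product of roots from bounds linear in [x]
    and [y], which pass through sums and integrals. The last two hypotheses settle the case where
    one of [x], [y] is 0 and the other [+oo], where the bounds in [t] say nothing. *)
Lemma le_sqrte_mul (R : realType) (x y z : \bar R) : 0 <= x -> 0 <= y ->
  (forall t : R, (0 < t)%R -> z <= t%:E * x + (4 * t)^-1%:E * y) ->
  z <= +oo * x -> z <= +oo * y -> z <= sqrte x * sqrte y.
Proof.
move=> x0 y0 zt zx zy.
move: x0; rewrite le_eqVlt => /predU1P[x0|x0].
  by rewrite -x0 sqrte0 mul0e; move: zx; rewrite -x0 mule0.
move: y0; rewrite le_eqVlt => /predU1P[y0|y0].
  by rewrite -y0 sqrte0 mule0; move: zy; rewrite -y0 mule0.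
have sgt0 (a : \bar R) : 0 < a -> 0 < sqrte a.
  by case: a => [a| |]//=; rewrite !lte_fin sqrtr_gt0.
case: x => [x| |]// in x0 zt zx *; last by rewrite gt0_mulye ?leey ?sgt0.
case: y => [y| |]// in y0 zt zy *; last by rewrite gt0_muley ?leey ?sgt0.
move: x0 y0; rewrite !lte_fin => x0 y0.
have a0 : (0 < Num.sqrt x)%R by rewrite sqrtr_gt0.
have b0 : (0 < Num.sqrt y)%R by rewrite sqrtr_gt0.
(* This [t] minimises [t x + y / (4 t)]: both terms become half of the product of the roots. *)
apply: (le_trans (zt (Num.sqrt y / (2 * Num.sqrt x))%R _)).
  by rewrite divr_gt0 ?mulr_gt0.
rewrite /= -!EFinM -EFinD lee_fin.
move: (sqr_sqrtr (ltW x0)) (sqr_sqrtr (ltW y0)) a0 b0.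
set a := Num.sqrt x; set b := Num.sqrt y => <- <- a0 b0.
rewrite le_eqVlt; apply/orP; left; apply/eqP; field.
by rewrite !gt_eqF.
Qed.

(** Hypothesis and conclusion have the same shape, so that this lemma and its integral analogue can
    be nested: the conclusion for an inner sum or integral is the termwise hypothesis of the outer
    one. *)
Lemma sume_cauchy_schwarz (R : realType) (I : Type) (r : seq I) (P : pred I)
    (f F G : I -> \bar R) :
  (forall i, P i -> 0 <= F i) -> (forall i, P i -> 0 <= G i) ->
  (forall i, P i -> `|f i| <= sqrte (F i) * sqrte (G i)) ->
  `|\sum_(i <- r | P i) f i| <=
    sqrte (\sum_(i <- r | P i) F i) * sqrte (\sum_(i <- r | P i) G i).
Proof.
move=> F0 G0 fFG; apply: le_trans (lee_abs_sum _ _ _) _.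
apply: le_sqrte_mul; rewrite ?sume_ge0//.
- move=> t t0; rewrite !ge0_sume_distrr// -big_split/=.
  apply: lee_sum => i Pi; apply: le_trans (fFG i Pi) _.
  by apply: sqrte_mul_le_amgm; auto.
- rewrite ge0_sume_distrr//; apply: lee_sum => i Pi.
  by apply: le_trans (fFG i Pi) _; apply: sqrte_mul_le_mulyl; exact: F0.
- rewrite ge0_sume_distrr//; apply: lee_sum => i Pi.
  apply: le_trans (fFG i Pi) _; rewrite muleC.
  by apply: sqrte_mul_le_mulyl; exact: G0.
Qed.

Section integral.
Context d (T : measurableType d) (R : realType).
Variables (mu : {measure set T -> \bar R}) (D : set T).
Implicit Types f F G : T -> \bar R.

(* The integral of a nonnegative function is a supremum over the simple
   functions below it, so neither side needs to be measurable. *)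
Lemma nonmeasurable_le_integral f F :
  (forall x, D x -> 0 <= f x) -> (forall x, D x -> f x <= F x) ->
  \int[mu]_(x in D) f x <= \int[mu]_(x in D) F x.
Proof.
move=> f0 fF; rewrite !ge0_integralE//; last first.
  by move=> x Dx; exact: le_trans (f0 _ Dx) (fF _ Dx).
apply: ereal_sup_le => _ [h hf <-]; exists h => // x.
apply: le_trans (hf x) _; rewrite /patch; case: ifPn => // xD.
by apply: fF; rewrite inE in xD.
Qed.

(** The positive and negative parts of [f] both lie below [F], and two nonnegative numbers bounded
    by [i] differ by at most [i]; if one of the two integrals is infinite, so is the bound. *)
Lemma nonmeasurable_abse_integral_le f F :
  (forall x, D x -> `|f x| <= F x) ->
  `|\int[mu]_(x in D) f x| <= \int[mu]_(x in D) F x.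
Proof.
move=> fF; rewrite integralE.
set P := integral mu D f^\+; set N := integral mu D f^\-.
have leP : P <= \int[mu]_(x in D) F x.
  apply: nonmeasurable_le_integral => // x Dx; apply: le_trans (fF x Dx).
  by rewrite funeposE ge_max lee_abs abse_ge0.
have leN : N <= \int[mu]_(x in D) F x.
  apply: nonmeasurable_le_integral => // x Dx; apply: le_trans (fF x Dx).
  by rewrite funenegE ge_max abse_ge0 andbT -abseN lee_abs.
have P0 : 0 <= P by apply: integral_ge0.
have N0 : 0 <= N by apply: integral_ge0.
move: P0 N0 leP leN; case: P => [p| |]//; case: N => [n| |]//=;
  case: (integral _ _ _) => [i| |]//=; rewrite ?lee_fin ?leey// => *.
by rewrite ler_norml; lra.
Qed.

(** Measurability of [F] and [G] serves to split the integral of [t F + G / (4 t)]; [f] enters only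
    through monotonicity. *)
Lemma integral_cauchy_schwarz f F G : measurable D ->
  measurable_fun D F -> measurable_fun D G ->
  (forall x, D x -> 0 <= F x) -> (forall x, D x -> 0 <= G x) ->
  (forall x, D x -> `|f x| <= sqrte (F x) * sqrte (G x)) ->
  `|\int[mu]_(x in D) f x| <=
    sqrte (\int[mu]_(x in D) F x) * sqrte (\int[mu]_(x in D) G x).
Proof.
move=> mD mF mG F0 G0 fFG.
apply: le_sqrte_mul; rewrite ?integral_ge0//.
- move=> t t0; have t4 : (0 <= (4 * t)^-1)%R by rewrite invr_ge0 mulr_ge0// ltW.
  rewrite -!ge0_integralZl ?lee_fin ?(ltW t0)// -ge0_integralD//.
  + apply: nonmeasurable_abse_integral_le => x Dx; apply: le_trans (fFG x Dx) _.
    by apply: sqrte_mul_le_amgm; auto.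
  + by move=> x Dx; rewrite mule_ge0 ?lee_fin ?(ltW t0)//; exact: F0.
  + exact: measurable_funeM.
  + by move=> x Dx; rewrite mule_ge0 ?lee_fin//; exact: G0.
  + exact: measurable_funeM.
- rewrite -ge0_integralZl//; apply: nonmeasurable_abse_integral_le => x Dx.
  by apply: le_trans (fFG x Dx) _; apply: sqrte_mul_le_mulyl; exact: F0.
- rewrite -ge0_integralZl//; apply: nonmeasurable_abse_integral_le => x Dx.
  apply: le_trans (fFG x Dx) _; rewrite muleC.
  by apply: sqrte_mul_le_mulyl; exact: G0.
Qed.

End integral.
End CauchySchwarz.

(** * Measurability of the kernel and of the strip integrals *)

Section Measurability.
Context {R : realType}.
Implicit Types (M : mesh R) (j : int) (delta : R) (gamma u : R -> R).

(** Local integrability makes [s ^+ 2 * gamma s] measurable; multiplying by [s ^- 2], continuous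
    away from 0, recovers [gamma] on an interval open at 0. *)
Lemma is_kernel_measurable delta gamma (r : R) :
  is_kernel delta gamma -> measurable_fun `]0, r[ gamma.
Proof.
move=> hg; have [mg _ _] := kernel_loc hg.
apply: (eq_measurable_fun (fun s : R => s ^- 2 * (s ^+ 2 * gamma s))).
  move=> s; rewrite inE/= in_itv/= => /andP[s0 _].
  by rewrite mulrA mulVf ?mul1r// sqrf_eq0 gt_eqF.
apply: measurable_funM; last exact: measurable_funS mg.
apply: open_continuous_measurable_fun; first exact: interval_open.
move=> s; rewrite inE/= in_itv/= => /andP[s0 _].
apply: cvgV; first by rewrite sqrf_eq0 gt_eqF.
exact: exprn_continuous.
Qed.

Lemma measurable_dg_energy_space a b delta gamma M k u :
  dg_energy_space a b delta gamma M k u -> measurable_fun setT u.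
Proof.
move=> [p [[pL _ _] _] [q [[qL _ _] _] <-]].
have mL (v : R -> R) : v \in Lfun lebesgue_measure 2%:E -> measurable_fun setT v.
  by rewrite inE => /andP[]; rewrite inE.
by apply: measurable_funD; exact: mL.
Qed.

Lemma measurable_strip M j :
  measurable [set p : R * R | strip M j p.1 p.2].
Proof.
rewrite (_ : [set p : R * R | strip M j p.1 p.2] = setT `&`
   (fun p : R * R => (node M j - p.1 < p.2) && (p.2 < node M j))
     @^-1` [set true]);
  last first.
  by apply/seteqP; split=> [[s x]|[s x]]; rewrite /strip/= in_itv/= => // -[].
apply: (_ : measurable_fun setT _) => //; apply: measurable_and.
  by apply: measurable_fun_ltr => //; apply: measurable_funB.
by apply: measurable_fun_ltr.
Qed.

Lemma measurable_gdiff delta M u j : measurable_fun setT u ->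
  measurable_fun setT (fun p : R * R => gdiff delta M u j p.2 p.1).
Proof.
move=> um; rewrite /gdiff.
have msd : measurable_fun setT (fun p : R * R => shift_diff u p.1 p.2).
  apply: measurable_funB; last exact: measurableT_comp.
  by apply: (measurableT_comp um); apply: measurable_funD.
apply: measurable_fun_ifT => //; last exact: measurable_funB.
apply: measurable_and.
  apply/(measurable_fun_bool true); rewrite setTI.
  rewrite (_ : _ @^-1` _ = [set p : R * R | strip M j p.1 p.2]).
    exact: measurable_strip.
  by apply/seteqP; split=> p /= ?; [exact: set_mem|exact: mem_set].
by apply: measurable_and; apply: measurable_fun_ltr.
Qed.

Lemma measurable_gdiff_sqr delta M u j (s : R) (A : set R) :
  measurable_fun setT u ->
  measurable_fun A (fun x => (gdiff delta M u j x s ^+ 2)%:E).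
Proof.
move=> /(measurable_gdiff delta M _ j) mg; apply: measurable_funTS.
apply/measurable_EFinP; apply: measurable_funX; exact: measurable_fun_pair2 mg.
Qed.

(** Tonelli's theorem. As the domain [D s] moves with [s], the integrand is restricted to the planar
    set of pairs [(s, x)] with [x] in [D s] and integrated over the whole line. *)
Lemma measurable_integral_gdiff_sqr delta M u j (D : R -> set R) (A : set R) :
  measurable_fun setT u -> measurable [set p : R * R | D p.1 p.2] ->
  measurable_fun A (fun s =>
    \int[lebesgue_measure]_(x in D s) (gdiff delta M u j x s ^+ 2)%:E)%E.
Proof.
move=> um mD; apply: measurable_funTS.
pose f (p : R * R) := (gdiff delta M u j p.2 p.1 ^+ 2)%:E.
have mf : measurable_fun setT (f \_ [set p : R * R | D p.1 p.2]).
  apply/(measurable_restrictT _ mD).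
  apply: measurable_funS measurableT _ _ => //.
  by apply/measurable_EFinP; apply: measurable_funX; exact: measurable_gdiff.
have f0 p : (0 <= (f \_ [set p : R * R | D p.1 p.2]) p)%E.
  by apply: erestrict_ge0 => ? _; rewrite lee_fin sqr_ge0.
have := @measurable_fun_fubini_tonelli_F _ _ R (measurableTypeR R) R
  lebesgue_measure _ mf f0.
apply: eq_measurable_fun => s _; rewrite /fubini_F [RHS]integral_mkcond.
apply: eq_integral => x _; rewrite /patch /=.
congr (if _ then _ else _); apply/idP/idP; rewrite !inE//.
Qed.

End Measurability.

(** * Cauchy-Schwarz bounds for E, P and the strip integrals of K *)

Section FormBounds.
Context {R : realType}.
Implicit Types (M : mesh R) (j : int) (delta mu : R) (gamma u v : R -> R).
Local Open Scope ereal_scope.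

(** Three nested Cauchy-Schwarz inequalities: in [s], over the cells, and in [x]. The weights 2 and
    [gamma s] are shared equally between the two roots. *)
Lemma form_E_le delta gamma M u v : is_kernel delta gamma ->
  measurable_fun setT u -> measurable_fun setT v ->
  `|form_E delta gamma M u v| <=
    sqrte (form_E delta gamma M u u) * sqrte (form_E delta gamma M v v).
Proof.
move=> hg um mv; have g0 s := kernel_ge0 hg s.
rewrite /form_E !sqrteM// muleACA -sqrteM// -EFinM [sqrte (_ * _)%:E]/=.
rewrite -expr2 sqrtr_sqr ger0_norm// abseM gee0_abs//.
rewrite lee_pmul2l//.
set G := fun w s => (gamma s)%:E * \sum_(j <- mesh_idx M)
  \int[lebesgue_measure]_(x in cell M j) (gdiff delta M w j x s ^+ 2)%:E.
have G0 w s : 0 <= G w s.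
  rewrite mule_ge0 ?lee_fin// sume_ge0// => j _.
  by apply: integral_ge0 => x _; rewrite lee_fin sqr_ge0.
have mG w : measurable_fun setT w -> measurable_fun `]0%R, delta[ (G w).
  move=> mw; apply: emeasurable_funM.
    by apply/measurable_EFinP; exact: (is_kernel_measurable _ _ _ hg).
  apply: emeasurable_sum => j.
  apply: (measurable_integral_gdiff_sqr _ _ _ _ (fun=> cell M j)) => //.
  rewrite (_ : [set p | _] = [set: R] `*` cell M j).
    by apply: measurableX => //; exact: measurable_itv.
  by apply/seteqP; split => p //= [].
have GE w s : G w s = (gamma s)%:E * \sum_(j <- mesh_idx M)
  \int[lebesgue_measure]_(x in cell M j)
     (gdiff delta M w j x s * gdiff delta M w j x s)%:E by [].
under [in X in _ <= sqrte X * _]eq_integral do rewrite -GE.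
under [in X in _ <= _ * sqrte X]eq_integral do rewrite -GE.
apply: integral_cauchy_schwarz => //; [exact: mG|exact: mG|move=> s _].
rewrite /G !sqrteM ?lee_fin// muleACA -sqrteM ?lee_fin// -EFinM.
rewrite [sqrte (_ * _)%:E]/= -expr2 sqrtr_sqr ger0_norm// abseM gee0_abs ?lee_fin//.
apply: lee_wpmul2l; rewrite ?lee_fin//.
apply: sume_cauchy_schwarz => [j _|j _|j _].
- by apply: integral_ge0 => x _; rewrite lee_fin sqr_ge0.
- by apply: integral_ge0 => x _; rewrite lee_fin sqr_ge0.
apply: integral_cauchy_schwarz => //.
- exact: measurable_itv.
- exact: (measurable_gdiff_sqr _ _ _ _ _ _ um).
- exact: (measurable_gdiff_sqr _ _ _ _ _ _ mv).
- by move=> x _; rewrite lee_fin sqr_ge0.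
- by move=> x _; rewrite lee_fin sqr_ge0.
- by move=> x _; rewrite /= !sqrtr_sqr normrM.
Qed.

Lemma form_P_ge0 delta gamma M v : is_kernel delta gamma ->
  0 <= form_P delta gamma M v v.
Proof.
move=> hg; rewrite mule_ge0 ?integral_ge0// => [s _|].
  by rewrite lee_fin mulr_ge0 ?sqr_ge0 ?(kernel_ge0 hg).
by apply: sume_ge0 => j _; rewrite lee_fin -expr2 sqr_ge0.
Qed.

Lemma form_P_le delta gamma M u v : is_kernel delta gamma ->
  `|form_P delta gamma M u v| <=
    sqrte (form_P delta gamma M u u) * sqrte (form_P delta gamma M v v).
Proof.
move=> hg; rewrite /form_P; set c := integral _ _ _.
have c0 : 0 <= c.
  apply: integral_ge0 => s _.
  by rewrite lee_fin mulr_ge0 ?sqr_ge0 ?(kernel_ge0 hg).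
rewrite !sqrteM// muleACA -sqrteM// -expe2 sqrte_sqr abseM.
apply: lee_wpmul2l => //.
apply: sume_cauchy_schwarz => j _; rewrite ?lee_fin -?expr2 ?sqr_ge0//.
by rewrite /= !sqrtr_sqr normrM.
Qed.

(** Cauchy-Schwarz against the constant 1, the strip having length [s]. *)
Lemma integral_strip_le delta M u j (s : R) : (0 < s)%R ->
  measurable_fun setT u ->
  `|\int[lebesgue_measure]_(x in strip M j s) (gdiff delta M u j x s)%:E| <=
    sqrte s%:E * sqrte (\int[lebesgue_measure]_(x in strip M j s)
                          (gdiff delta M u j x s ^+ 2)%:E).
Proof.
move=> s0 um.
have mE : lebesgue_measure (strip M j s) = s%:E.
  rewrite lebesgue_measure_itv/= lte_fin ltrBlDr ltrDl s0 -EFinB.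
  by congr (_%:E); ring.
have -> : s%:E = \int[lebesgue_measure]_(x in strip M j s) 1%:E.
  by rewrite integral_cst ?mul1e; [exact/esym|exact: measurable_itv].
apply: integral_cauchy_schwarz => //.
- exact: measurable_itv.
- exact: (measurable_gdiff_sqr _ _ _ _ _ _ um).
- by move=> x _; rewrite lee_fin sqr_ge0.
- by move=> x _; rewrite /= sqrtr1 mul1e sqrtr_sqr.
Qed.

Lemma integral_kernel_strip_le delta gamma M u j (r : R) :
  is_kernel delta gamma -> measurable_fun setT u ->
  `|\int[lebesgue_measure]_(s in `]0%R, r[)
      ((gamma s)%:E * \int[lebesgue_measure]_(x in strip M j s)
                        (gdiff delta M u j x s)%:E)| <=
  sqrte (\int[lebesgue_measure]_(s in `]0%R, r[) (s ^+ 2 * gamma s)%:E) *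
  sqrte (\int[lebesgue_measure]_(s in `]0%R, r[)
      ((gamma s / s)%:E * \int[lebesgue_measure]_(x in strip M j s)
                            (gdiff delta M u j x s ^+ 2)%:E)).
Proof.
move=> hg um; have g0 s := kernel_ge0 hg s.
have mg := is_kernel_measurable delta gamma r hg.
have I0 s : 0 <= \int[lebesgue_measure]_(x in strip M j s)
    (gdiff delta M u j x s ^+ 2)%:E.
  by apply: integral_ge0 => x _; rewrite lee_fin sqr_ge0.
apply: integral_cauchy_schwarz => //.
- by apply/measurable_EFinP; apply: measurable_funM.
- apply: emeasurable_funM.
    apply/measurable_EFinP; apply: measurable_funM => //.
    apply: open_continuous_measurable_fun; first exact: interval_open.
    move=> s; rewrite inE/= in_itv/= => /andP[s0 _].
    by apply: inv_continuous; rewrite gt_eqF.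
  apply: measurable_integral_gdiff_sqr => //.
  exact: measurable_strip.
- by move=> s _; rewrite lee_fin mulr_ge0 ?sqr_ge0 ?g0.
- move=> s; rewrite /= in_itv/= => /andP[s0 _].
  by rewrite mule_ge0 ?lee_fin ?divr_ge0 ?g0 ?(ltW s0).
move=> s sr; have s0 : (0 < s)%R by move: sr; rewrite /= in_itv/= => /andP[].
rewrite -sqrteM; last by rewrite lee_fin mulr_ge0 ?sqr_ge0 ?g0.
rewrite muleA -EFinM.
(* The root of the product of the two weights is [gamma s] times the root of [s], exactly the factor
   left by the strip bound. *)
have -> : (s ^+ 2 * gamma s * (gamma s / s) = gamma s ^+ 2 * s)%R.
  by field; rewrite gt_eqF.
rewrite EFinM -muleA sqrteM ?lee_fin ?sqr_ge0// [sqrte (_ ^+ 2)%:E]/= sqrtr_sqr.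
rewrite abseM -[`|(gamma s)%:E|]/(`|gamma s|%:E) sqrteM ?lee_fin ?(ltW s0)//.
by apply: lee_wpmul2l; rewrite ?lee_fin//; exact: integral_strip_le.
Qed.

End FormBounds.

(** * Bound of K by the J-seminorm and the penalty *)

Section PenaltyBound.
Context {R : realType}.
Implicit Types (M : mesh R) (j : int) (delta mu : R) (gamma u v : R -> R).
Local Open Scope ereal_scope.

Lemma seminormJ_sq_ge0 delta gamma M v : is_kernel delta gamma ->
  (forall j, j \in mesh_idx M -> (0 <= cell_size M j)%R) ->
  0 <= seminormJ_sq delta gamma M v.
Proof.
move=> hg h0; rewrite mule_ge0// big_seq sume_ge0// => j jM.
rewrite mule_ge0 ?lee_fin ?h0// integral_ge0// => s.
rewrite /= in_itv/= => /andP[s0 _].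
rewrite mule_ge0 ?lee_fin ?divr_ge0 ?(kernel_ge0 hg) ?(ltW s0)//.
by apply: integral_ge0 => x _; rewrite lee_fin sqr_ge0.
Qed.

Lemma form_E_ge0 delta gamma M v : is_kernel delta gamma ->
  0 <= form_E delta gamma M v v.
Proof.
move=> hg; rewrite mule_ge0// integral_ge0// => s _.
rewrite mule_ge0 ?lee_fin ?(kernel_ge0 hg)// sume_ge0// => j _.
by apply: integral_ge0 => x _; rewrite lee_fin -expr2 sqr_ge0.
Qed.

Lemma form_K_le delta gamma M mu u v : is_kernel delta gamma ->
  measurable_fun setT u -> (0 < mu)%R ->
  (forall j, j \in mesh_idx M -> (1 <= mu * cell_size M j)%R) ->
  `|form_K delta gamma M u v| <=
    sqrte (2%:E * seminormJ_sq delta gamma M u) *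
    sqrte (mu%:E * form_P delta gamma M v v).
Proof.
move=> hg um mu0 hmu.
have h0 j : j \in mesh_idx M -> (0 < cell_size M j)%R.
  by move=> /hmu h; rewrite -(pmulr_rgt0 _ mu0) (lt_le_trans ltr01).
rewrite /form_K /seminormJ_sq /form_P.
set c := (X in _ <= _ * sqrte (_ * (X * _))).
have c0 : 0 <= c.
  apply: integral_ge0 => s _.
  by rewrite lee_fin mulr_ge0 ?sqr_ge0 ?(kernel_ge0 hg).
pose A j := \int[lebesgue_measure]_(s in `]0%R, (h_hat delta M)[)
  ((gamma s / s)%:E * \int[lebesgue_measure]_(x in strip M j s)
                        (gdiff delta M u j x s ^+ 2)%:E).
have A0 j : 0 <= A j.
  apply: integral_ge0 => s; rewrite /= in_itv/= => /andP[s0 _].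
  rewrite mule_ge0 ?lee_fin ?divr_ge0 ?(kernel_ge0 hg) ?(ltW s0)//.
  by apply: integral_ge0 => x _; rewrite lee_fin sqr_ge0.
(* The explicit 2 and the 2 inside [seminormJ_sq] combine to 4, whose root cancels the factor 2 of
   [form_K]. *)
have four2 (x : \bar R) : sqrte (2%:E * (2%:E * x)) = 2%:E * sqrte x.
  by rewrite muleA -EFinM sqrteM// /= -expr2 sqrtr_sqr ger0_norm.
rewrite four2.
rewrite abseM gee0_abs// -muleA lee_pmul2l//.
(* Cauchy-Schwarz over the cells with weights [h_j] and [1 / h_j]; afterwards [1 / h_j <= mu] turns
   the second root into the penalty term. *)
apply: (@le_trans _ _ (sqrte (\sum_(j <- mesh_idx M) (cell_size M j)%:E * A j) *
  sqrte (\sum_(j <- mesh_idx M) (jump M v j ^+ 2 / cell_size M j)%:E * c))).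
  rewrite 3!big_seq; apply: sume_cauchy_schwarz => j jM.
  - by rewrite mule_ge0 ?lee_fin ?(ltW (h0 j jM)).
  - by rewrite mule_ge0 ?lee_fin ?divr_ge0 ?sqr_ge0 ?(ltW (h0 j jM)).
  have h0j := h0 j jM.
  rewrite -sqrteM; last by rewrite mule_ge0 ?lee_fin ?(ltW h0j).
  rewrite muleACA -EFinM.
  have -> : (cell_size M j * (jump M v j ^+ 2 / cell_size M j) =
             jump M v j ^+ 2)%R by field; rewrite gt_eqF.
  rewrite sqrteM ?lee_fin ?sqr_ge0// [sqrte (_ ^+ 2)%:E]/= sqrtr_sqr.
  rewrite abseM -[`|(jump M v j)%:E|]/(`|jump M v j|%:E).
  apply: lee_wpmul2l; rewrite ?lee_fin//.
  rewrite (muleC (A j)) sqrteM//; exact: integral_kernel_strip_le.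
apply: lee_wpmul2l; first exact: sqrte_ge0.
rewrite lee_sqrt; last first.
  rewrite mule_ge0 ?lee_fin ?(ltW mu0)// mule_ge0// sume_ge0// => j _.
  by rewrite lee_fin -expr2 sqr_ge0.
rewrite ge0_sume_distrr; last by move=> j _; rewrite lee_fin -expr2 sqr_ge0.
rewrite ge0_sume_distrr; last first.
  by move=> j _; rewrite mule_ge0// lee_fin -expr2 sqr_ge0.
rewrite big_seq [leRHS]big_seq; apply: lee_sum => j jM.
rewrite (muleC c) muleA -EFinM; apply: lee_wpmul2r => //.
rewrite lee_fin ler_pdivrMr ?h0// -expr2 mulrAC ler_peMl ?sqr_ge0//.
exact: hmu.
Qed.

End PenaltyBound.

(** * Positivity and minimality of the cell sizes *)

Section MeshSize.
Context {R : realType} {a b delta : R} {M : mesh R}.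

Lemma mem_mesh_idx (j : int) : (j \in mesh_idx M) =
  (- (nghost M)%:Z < j <= (ncell M + nghost M)%N%:Z).
Proof.
apply/mapP/idP => [[i]|hj].
  by rewrite mem_iota => hi ->; lia.
exists (absz (j + (nghost M)%:Z - 1)%R); last by lia.
by rewrite mem_iota; lia.
Qed.

Lemma cell_size_gt0 j :
  is_mesh a b delta M -> j \in mesh_idx M -> 0 < cell_size M j.
Proof.
move=> hM; rewrite mem_mesh_idx => hj; rewrite subr_gt0.
by apply: (node_lt hM); lia.
Qed.

Lemma ncell_gt0 : a < b -> is_mesh a b delta M -> (0 < ncell M)%N.
Proof.
move=> hab hM; rewrite lt0n; apply/eqP => n0; move: hab.
by rewrite -(node_a hM) -(node_b hM) n0 ltxx.
Qed.

Lemma mesh_min_gt0 : a < b -> is_mesh a b delta M -> 0 < mesh_min M.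
Proof.
move=> hab hM; rewrite /mesh_min big_seq; apply: lt_bigmin => [|j]; last exact: cell_size_gt0 hM.
(* The default value of the minimum is the size of cell 1, which belongs to the mesh because [a < b]
   forces [ncell M] to be positive. *)
apply: (cell_size_gt0 _ hM); rewrite mem_mesh_idx.
by have := ncell_gt0 hab hM; lia.
Qed.

Lemma mesh_min_le j : j \in mesh_idx M -> mesh_min M <= cell_size M j.
Proof. by move=> jM; apply: bigmin_inf_seq jM _ _. Qed.

End MeshSize.

(** * Assembling the bound with constant 2 *)

(* The bound is |L| |(e', j', p')| with L = (e, r p, r j + p), and
   |L|^2 <= 4 |(e, j, p)|^2. *)
Lemma penalty_cauchy_schwarz (R : realType) (e j p e' j' p' : R) :
  e * e' + (Num.sqrt 2 * j * p' + Num.sqrt 2 * j' * p) + p * p' <=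
  2 * Num.sqrt (e ^+ 2 + j ^+ 2 + p ^+ 2) *
      Num.sqrt (e' ^+ 2 + j' ^+ 2 + p' ^+ 2).
Proof.
have r2 : Num.sqrt 2 ^+ 2 = 2 :> R by rewrite sqr_sqrtr.
move: (Num.sqrt 2) r2 => r r2.
set X := e ^+ 2 + j ^+ 2 + p ^+ 2; set Y := e' ^+ 2 + j' ^+ 2 + p' ^+ 2.
set L := (X in X <= _).
have X0 : 0 <= X by rewrite !addr_ge0 ?sqr_ge0.
have Y0 : 0 <= Y by rewrite !addr_ge0 ?sqr_ge0.
have : L ^+ 2 <= 4 * X * Y.
  rewrite -subr_ge0.
  (* Lagrange's identity: the last three squares are the 2 by 2 minors of [(e, r p, r j + p)] and
     [(e', j', p')], and the factor of [Y] is [4 X] minus the squared length of the first vector. *)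
  have -> : 4 * X * Y - L ^+ 2 =
      (3 * e ^+ 2 + (r * j - p) ^+ 2) * Y + (e * j' - r * p * e') ^+ 2
      + (e * p' - (r * j + p) * e') ^+ 2 + (r * p * p' - (r * j + p) * j') ^+ 2.
    have -> : 4 = 2 + r ^+ 2 :> R by rewrite r2; ring.
    rewrite /X /Y /L; ring: r2.
  by rewrite !addr_ge0 ?sqr_ge0// mulr_ge0// addr_ge0 ?sqr_ge0// mulr_ge0 ?sqr_ge0.
move=> L2; apply: le_trans (ler_norm L) _.
rewrite -sqrtr_sqr; apply: (le_trans (ler_wsqrtr L2)).
rewrite sqrtrM ?mulr_ge0// sqrtrM// (_ : 4 = 2 ^+ 2); last by ring.
by rewrite sqrtr_sqr ger0_norm.
Qed.

(** If one norm is 0, all its components are 0 and both sides vanish, even against an infinite norm.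
    If both are nonzero and one is infinite, the right side is [+oo]. The remaining case is the real
    inequality. *)
Lemma sqrte_penalty_cauchy_schwarz (R : realType) (a b c a' b' c' : \bar R) :
  (0 <= a -> 0 <= b -> 0 <= c -> 0 <= a' -> 0 <= b' -> 0 <= c' ->
  sqrte a * sqrte a' + (sqrte (2%:E * b) * sqrte c' + sqrte (2%:E * b') * sqrte c)
  + sqrte c * sqrte c' <=
  2%:E * sqrte (a + b + c) * sqrte (a' + b' + c'))%E.
Proof.
move=> a0 b0 c0 a'0 b'0 c'0.
have [X0|X0] := eqVneq (a + b + c)%E 0%E.
  move/eqP: X0; rewrite padde_eq0 ?adde_ge0// padde_eq0//.
  move=> /andP[/andP[/eqP-> /eqP->] /eqP->].
  by rewrite !(adde0, mule0, mul0e, sqrte0).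
have [Y0|Y0] := eqVneq (a' + b' + c')%E 0%E.
  move/eqP: Y0; rewrite padde_eq0 ?adde_ge0// padde_eq0//.
  move=> /andP[/andP[/eqP-> /eqP->] /eqP->].
  by rewrite !(adde0, mule0, mul0e, sqrte0).
have sgt0 (x : \bar R) : (0 <= x -> x != 0 -> 0 < sqrte x)%E.
  case: x => [x| |]//=; rewrite lee_fin lte_fin sqrtr_gt0 lt_neqAle => -> x0.
  by rewrite andbT eq_sym; apply: contra x0 => /eqP->.
have X0' : (0 < sqrte (a + b + c))%E by rewrite sgt0 ?adde_ge0.
have Y0' : (0 < sqrte (a' + b' + c'))%E by rewrite sgt0 ?adde_ge0.
have [Xoo|Xfin] := eqVneq (a + b + c)%E +oo%E.
  by rewrite Xoo [X in (_ <= X * _)%E]gt0_muley ?lte_fin// gt0_mulye ?leey.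
have [Yoo|Yfin] := eqVneq (a' + b' + c')%E +oo%E.
  by rewrite Yoo gt0_muley ?leey// mule_gt0.
move: a b c a' b' c' a0 b0 c0 a'0 b'0 c'0 Xfin Yfin {X0 Y0 X0' Y0' sgt0}.
move=> [a| |] [b| |] [c| |] [a'| |] [b'| |] [c'| |] //.
rewrite !lee_fin => a0 b0 c0 a'0 b'0 c'0 _ _ /=.
rewrite !sqrtrM//.
have := penalty_cauchy_schwarz _ (Num.sqrt a) (Num.sqrt b) (Num.sqrt c)
  (Num.sqrt a') (Num.sqrt b') (Num.sqrt c').
by rewrite !sqr_sqrtr.
Qed.

Lemma form_B_le (R : realType) (delta mu : R) (gamma : R -> R) (M : mesh R)
    (meth : dg_method) (v w : R -> R) :
  is_kernel delta gamma -> 0 < mu ->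
  (forall j, j \in mesh_idx M -> 1 <= mu * cell_size M j) ->
  measurable_fun setT v -> measurable_fun setT w ->
  (form_B meth delta gamma M mu v w <=
     2%:E * dg_norm delta gamma M mu v * dg_norm delta gamma M mu w)%E.
Proof.
move=> hg mu0 hmu mv mw.
have h0 j : j \in mesh_idx M -> 0 <= cell_size M j.
  by move=> /hmu h; rewrite -(pmulr_rge0 _ mu0) (le_trans ler01).
have P0 u : (0 <= mu%:E * form_P delta gamma M u u)%E.
  by rewrite mule_ge0 ?lee_fin ?(ltW mu0) ?form_P_ge0.
apply: le_trans (sqrte_penalty_cauchy_schwarz _ _ _ _ _ _ _ _ _ _ _ _ _) => //;
  try exact: form_E_ge0; try exact: seminormJ_sq_ge0.
apply: le_trans (lee_abs _) _.
apply: le_trans (lee_abs_add _ _) _; apply: leeD.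
  apply: le_trans (lee_abs_add _ _) _; apply: leeD; first exact: form_E_le.
  (* The two methods differ by the sign of one term, which the triangle inequality absorbs. *)
  have KK : (`|form_J meth delta gamma M v w| <=
      `|form_K delta gamma M v w| + `|form_K delta gamma M w v|)%E.
    by case: meth; [exact: lee_abs_add|exact: lee_abs_sub].
  by apply: le_trans KK _; apply: leeD; exact: form_K_le.
have sP u : (sqrte (mu%:E * form_P delta gamma M u u) =
    sqrte mu%:E * sqrte (form_P delta gamma M u u))%E.
  by rewrite sqrteM ?lee_fin ?(ltW mu0).
rewrite !sP muleACA -expe2 sqr_sqrte ?lee_fin ?(ltW mu0)//.
rewrite abseM gee0_abs ?lee_fin ?(ltW mu0)//.
apply: lee_wpmul2l; rewrite ?lee_fin ?(ltW mu0)//.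
exact: form_P_le.
Qed.

Theorem mainTheorem5 (R : realType) (a b delta : R) (gamma : R -> R)
    (M : mesh R) (k : nat) (nu mu Cmu : R) (meth : dg_method)
    (hab : a < b) (hdelta : 0 < delta)
    (hgamma : is_kernel delta gamma)
    (hM : is_mesh a b delta M)
    (hnu : 0 < nu) (hquasi : nu * mesh_size M <= mesh_min M)
    (hmu : 0 < mu) (hmuO : mu <= Cmu / mesh_size M)
    (hmu_ge : 1 / mesh_min M <= mu)
    (v w : R -> R)
    (hv : dg_energy_space a b delta gamma M k v)
    (hw : dg_energy_space a b delta gamma M k w) :
  (form_B meth delta gamma M mu v w <=
     2%:E * dg_norm delta gamma M mu v * dg_norm delta gamma M mu w)%E.
Proof.
apply: form_B_le => //; [|exact: measurable_dg_energy_space hv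
                         |exact: measurable_dg_energy_space hw].
(* The penalty condition gives [mu h_j >= 1] on each cell, since [mu] is at least the inverse of the
   smallest cell size. *)
move=> j jM; rewrite -(ler_pdivrMr _ _ (cell_size_gt0 _ hM jM)).
apply: le_trans hmu_ge; rewrite ler_pM2l// lef_pV2 ?posrE.
- exact: mesh_min_le jM.
- exact: cell_size_gt0 hM jM.
- exact: mesh_min_gt0 hab hM.
Qed.
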